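(* Let $\phi,\theta\in(0,1)$ and $r\ge1$ an integer. Let $R_\theta(\phi)=\{T\in\mathbb{Z}_{\ge1}:\{T\theta\}<\phi\}=\{T_1<T_2<\cdots\}$. Then the set $\{(T_{i+1}-T_i,\dots,T_{i+r}-T_{i+r-1}): i\ge1\}$ of consecutive $r$--differences of $R_\theta(\phi)$ has at most $2r+1$ elements.
   Context: $\{x\}$ denotes the fractional part of $x$. *)

(* Defs.v *)
From HB Require Import structures.
From mathcomp Require Import all_boot all_order all_algebra.
From mathcomp Require Import boolp classical_sets functions cardinality reals.
From mathcomp Require Import zify ring lra.

Set Implicit Arguments.
Unset Strict Implicit.
Unset Printing Implicit Defensive.

Import Order.TTheory GRing.Theory Num.Theory.

Local Open Scope classical_set_scope.
Local Open Scope ring_scope.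

Definition fract (R : realType) (x : R) : R := x - (Num.floor x)%:~R.

Definition return_times (R : realType) (theta phi : R) : set nat :=
  [set t | (1 <= t)%N /\ fract (t%:R * theta) < phi].

(* Indexing starts at 0: $A = \{T_1 < T_2 < \dots\}$ with $T_i$ = [T i.-1]. *)
Definition enumerates (T : nat -> nat) (A : set nat) : Prop :=
  {homo T : i j / (i < j)%N} /\ range T = A.

(* The [nat] subtractions never truncate when [T] is increasing. *)
Definition consecutive_differences (r : nat) (T : nat -> nat) :
    set (r.-tuple nat) :=
  range (fun i => [tuple (T (i + j.+1) - T (i + j))%N | j < r]).
Arguments consecutive_differences : clear implicits.

(* The enumeration exists, so hypotheses of the form
   [enumerates T (return_times theta phi)] with [0 < phi] are never vacuous. *)

Lemma fract_itv (R : realType) (x : R) : 0 <= fract x < 1.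
Proof. by rewrite /fract; have := floor_itv x; rewrite intrD; lra. Qed.

Lemma fract_eq (R : realType) (x y : R) (m : int) :
  x = m%:~R + y -> 0 <= y < 1 -> fract x = y.
Proof.
move=> -> y01; rewrite /fract (@floor_def _ _ m) ?intrD; lra.
Qed.

Lemma return_times_unbounded (R : realType) (theta phi : R) :
  0 < phi -> forall m : nat, exists2 t, (m < t)%N & return_times theta phi t.
Proof.
move=> phi0 m; pose x := m.+1%:R * theta.
suff [d d0 hd] : exists2 d : nat, (0 < d)%N & fract (d%:R * x) < phi.
  exists (d * m.+1)%N; first by nia.
  by split; [nia | rewrite natrM -mulrA].
pose n := (Num.truncn phi^-1).+1.
have n0 : 0 < n%:R :> R by rewrite ltr0n.
have hn : 1 < n%:R * phi.
  by rewrite -ltr_pdivrMr // div1r /n truncnS_gt.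
have bin k : (Num.truncn (n%:R * fract (k%:R * x)) < n)%N.
  have /andP[f0 f1] := fract_itv (k%:R * x).
  by rewrite truncn_lt_nat ?mulr_ge0 ?ler0n // gtr_pMr.
pose f (k : 'I_n.+1) : 'I_n := Ordinal (bin k).
have /injectivePn[i0 [j0 ij0 fij0]] : ~~ injectiveb f.
  apply/negP => /injectiveP /leq_card; rewrite !card_ord; lia.
have [i [j [ij fij]]] : exists i j : 'I_n.+1, (i < j)%N /\ f i = f j.
  case: (ltngtP i0 j0) => h; [by exists i0, j0 | by exists j0, i0 |].
  by move: ij0; rewrite (val_inj h) eqxx.
have {}fij := congr1 val fij; rewrite /= in fij.
have /andP[a0 a1] := fract_itv (i%:R * x).
have /andP[b0 b1] := fract_itv (j%:R * x).
have /andP[ta tA] : (Num.truncn (n%:R * fract (i%:R * x)))%:R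
    <= n%:R * fract (i%:R * x) <
    (Num.truncn (n%:R * fract (i%:R * x))).+1%:R.
  by apply: truncn_itv; nra.
have /andP[tb tB] : (Num.truncn (n%:R * fract (j%:R * x)))%:R
    <= n%:R * fract (j%:R * x) <
    (Num.truncn (n%:R * fract (j%:R * x))).+1%:R.
  by apply: truncn_itv; nra.
rewrite -fij in tb tB; rewrite -natr1 in tA tB.
pose d := (j - i)%N.
pose e := fract (j%:R * x) - fract (i%:R * x).
have e_lt : - phi < e < phi by apply/andP; split; rewrite /e; nra.
have de : d%:R * x
    = (Num.floor (j%:R * x) - Num.floor (i%:R * x))%:~R + e.
  rewrite /d natrB ?(ltnW ij) // rmorphB /= /e /fract; ring.
have d0 : (0 < d)%N by rewrite subn_gt0.
case: (leP 0 e) => e0.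
  by exists d => //; rewrite (fract_eq de); [lra | rewrite /e in e0 *; lra].
have ne0 : 0 < - e by lra.
pose k := Num.truncn (- e)^-1.
have /andP[k1 k2] : k%:R <= (- e)^-1 < k.+1%:R.
  by apply: truncn_itv; rewrite invr_ge0 ltW.
have ee : (- e)^-1 * (- e) = 1 by rewrite mulVf // gt_eqF.
have kk : (1 <= k)%N.
  by rewrite truncn_gt0 invf_ge1 //; rewrite /e in e0 *; lra.
have k1R : 1 <= k%:R :> R by rewrite ler1n.
rewrite -natr1 in k2.
exists (k * d)%N; first by rewrite muln_gt0 kk.
have kde : (k * d)%:R * x = (k%:Z * (Num.floor (j%:R * x) -
    Num.floor (i%:R * x)) - 1)%:~R + (1 + k%:R * e).
  rewrite natrM -mulrA de (rmorphB _ (_ * _)) rmorphM /= -pmulrn; ring.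
by rewrite (fract_eq kde); nra.
Qed.

Lemma return_times_enumerable (R : realType) (theta phi : R) :
  0 < phi -> exists T, enumerates T (return_times theta phi).
Proof.
move=> phi0; pose A := return_times theta phi.
have ex m : exists t, (m < t)%N && `[< A t >].
  have [t mt At] := return_times_unbounded theta phi0 m.
  by exists t; rewrite mt; apply/asboolP.
pose T := fix T n := if n is n'.+1 then ex_minn (ex (T n')) else ex_minn (ex 0%N).
have TS n : (T n < T n.+1)%N by rewrite /=; case: ex_minnP => t /andP[].
have TA n : A (T n).
  by case: n => [|n] /=; case: ex_minnP => t /andP[_ /asboolP].
have incT : {homo T : i j / (i < j)%N} by exact: homo_ltn ltn_trans TS.
exists T; split=> //; apply/seteqP; split=> [_ [n _ <-]|a Aa]; first exact: TA.
have geT n : (n <= T n)%N by elim: n => // k IH; exact: leq_ltn_trans IH (TS k).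
case: (ex_minnP (ex_intro (fun i => a <= T i)%N a (geT a))) => i ai mini.
exists i => //; apply/eqP; rewrite eqn_leq ai andbT.
case: i ai mini => [|i] ai mini /=; case: ex_minnP => t _; apply.
  by have [a1 _] := Aa; rewrite a1; apply/asboolP.
apply/andP; split; last exact/asboolP.
by rewrite ltnNge; apply/negP => /mini; rewrite ltnn.
Qed.

(* Main.v *)
(* Slide x from left to right through [0, phi) and watch its next r return
   times to [0, phi) under rotation by theta.  They can change only at a point c
   whose orbit meets an endpoint 0 or phi of the interval, after fewer than r
   intermediate returns.  Such a c is the k-th backward return of 0 or of phi
   for some k <= r, so there are at most 2r of them; the number of these points
   that are <= x takes at most 2r + 1 values and determines the r differences. *)
Require Import Defs.
From HB Require Import structures.
From mathcomp Require Import all_boot all_order all_algebra.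
From mathcomp Require Import boolp classical_sets functions cardinality reals.
From mathcomp Require Import zify ring lra.

Set Implicit Arguments.
Unset Strict Implicit.
Unset Printing Implicit Defensive.

Import Order.TTheory GRing.Theory Num.Theory.

Local Open Scope classical_set_scope.
Local Open Scope ring_scope.
Local Open Scope card_scope.

Lemma fractE (R : realType) (x : R) : x = (Num.floor x)%:~R + fract x.
Proof. by rewrite /fract; ring. Qed.

Lemma fractDz (R : realType) (m : int) (x y : R) :
  x = m%:~R + y -> fract x = fract y.
Proof.
move=> xE; apply: (@fract_eq _ _ _ (m + Num.floor y)); last exact: fract_itv.
by rewrite rmorphD /= xE {1}(fractE y) addrA.
Qed.

Lemma fract_fractD (R : realType) (x y : R) : fract (fract x + y) = fract (x + y).
Proof.
apply: (@fractDz _ (- Num.floor x)).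
by rewrite rmorphN /= /fract; ring.
Qed.

Lemma fract_id (R : realType) (x : R) : 0 <= x < 1 -> fract x = x.
Proof. by apply: (@fract_eq _ _ _ 0); rewrite add0r. Qed.

Definition hit (R : realType) (theta phi x : R) (v : nat) : bool :=
  fract (x + v%:R * theta) < phi.

(** Times 0 and [u] are both excluded, so only intermediate hits are counted. *)
Definition nhits (h : nat -> bool) (u : nat) : nat := \sum_(1 <= v < u) h v.

Lemma nhitsS h u : (0 < u)%N -> nhits h u.+1 = (nhits h u + h u)%N.
Proof. by move=> u0; rewrite /nhits big_nat_recr. Qed.

Lemma leq_nhits h u u' : (u <= u')%N -> (nhits h u <= nhits h u')%N.
Proof.
case: (posnP u) => [-> _|u0 uu']; first by rewrite {1}/nhits big_geq.
by rewrite {2}/nhits (big_cat_nat _ (n := u)) //= leq_addr.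
Qed.

Lemma nhits_rev (h g : nat -> bool) u :
  (forall v, (0 < v < u)%N -> h (u - v)%N = g v) -> nhits h u = nhits g u.
Proof.
move=> hg; rewrite /nhits big_nat_rev /=; apply: eq_big_nat => v vu.
by rewrite add1n subSS hg.
Qed.

Definition endpoint (R : realType) (phi : R) (b : bool) : R := if b then phi else 0.

(* [c] is the (k+1)-st point of the backward orbit of an endpoint that lies in
   [0, phi). *)
Definition cut (R : realType) (theta phi : R) (b : bool) (k : nat) (c : R) : Prop :=
  exists u, [/\ (0 < u)%N, c = fract (endpoint phi b - u%:R * theta), c < phi &
    nhits (hit (- theta) phi (endpoint phi b)) u = k].

(** If times [u < w] both qualify, then [u] is itself a backward hit because [c < phi]. It is
    counted before [w] but not before [u], so the two counts differ. *)
Lemma cut_unique (R : realType) (theta phi : R) b k c c' :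
  cut theta phi b k c -> cut theta phi b k c' -> c = c'.
Proof.
move=> [u [u0 -> cu ku]] [w [w0 -> cw kw]].
wlog uw : u w u0 cu ku w0 cw kw / (u < w)%N.
  move=> H; case: (ltngtP u w) => [uw|uw|->//]; first exact: H.
  by apply/esym/H.
have := leq_nhits (hit (- theta) phi (endpoint phi b)) uw.
rewrite nhitsS // ku kw {1}/hit mulrN cu; lia.
Qed.

(** As the starting point moves from [x] to [y], its translate moves rigidly on the circle and can
    enter or leave the interval only through 0 or [phi]. *)
Lemma hit_eq_nocross (R : realType) (theta phi x y : R) u :
  0 < phi < 1 -> 0 <= x -> x <= y -> y < phi ->
  (forall b c, x < c -> c <= y -> fract (c + u%:R * theta) <> endpoint phi b) ->
  hit theta phi x u = hit theta phi y u.
Proof.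
move=> phi01 x0 xy yphi nc; rewrite /hit.
have := fractE (x + u%:R * theta); have := fract_itv (x + u%:R * theta).
set X := fract (x + _); set m := Num.floor _ => X01 XE.
have shift : y + u%:R * theta = m%:~R + (X + (y - x)) by lra.
(* Otherwise the translate wraps around, and it is at 0 for the starting point [x + (1 - X)]. *)
have Xy : X + (y - x) < 1.
  rewrite ltNge; apply/negP => X1.
  apply: (nc false (x + (1 - X))); [lra | lra |].
  by apply: (@fract_eq _ _ _ (m + 1)); rewrite ?rmorphD /=; lra.
rewrite (fract_eq shift); last by lra.
case: (ltP X phi) => Xphi; last by apply/esym/negbTE; rewrite -leNgt; lra.
apply/esym; rewrite ltNge; apply/negP => phiX.
apply: (nc true (x + (phi - X))); [lra | lra |].
by apply: (@fract_eq _ _ _ m); rewrite /endpoint; lra.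
Qed.

Lemma hit_eq (R : realType) (theta phi x y : R) r u :
  0 < phi < 1 -> 0 <= x -> x <= y -> y < phi ->
  (forall b k c, (k < r)%N -> x < c -> c <= y -> ~ cut theta phi b k c) ->
  (0 < u)%N -> (nhits (hit theta phi x) u < r)%N ->
  hit theta phi x u = hit theta phi y u.
Proof.
move=> phi01 x0 xy yphi nocut u0 ur.
apply: hit_eq_nocross => // b0 c0 xc0 cy0 cross0.
pose crossing w := (0 < w)%N && `[< exists b c, [/\ x < c, c <= y &
   fract (c + w%:R * theta) = endpoint phi b] >].
have ex : exists w, crossing w.
  by exists u; rewrite /crossing u0; apply/asboolP; exists b0, c0.
(* At the earliest crossing time [w], the points [x] and [c] still have the same hits before [w].
   There are fewer than [r] of them, and this number is the index of [c] as a cut. *)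
case: (ex_minnP ex) => w /andP[w0 /asboolP[b [c [xc cy cross]]]] wmin.
have wu : (w <= u)%N.
  by apply: wmin; rewrite /crossing u0; apply/asboolP; exists b0, c0.
have agree v : (0 < v < w)%N -> hit theta phi x v = hit theta phi c v.
  move=> /andP[v0 vw]; apply: hit_eq_nocross => //; [lra | lra |].
  move=> b' c' xc' cc' cross'.
  suff : (w <= v)%N by rewrite leqNgt vw.
  apply: wmin; rewrite /crossing v0; apply/asboolP; exists b', c'.
  by split => //; lra.
(* Read backward from time [w], the orbit of [c] is the backward orbit of the endpoint. *)
have back v : (v <= w)%N ->
    fract (c + (w - v)%:R * theta) = fract (endpoint phi b + v%:R * - theta).
  move=> vw; apply: (@fractDz _ (Num.floor (c + w%:R * theta))).
  by rewrite -cross natrB // /fract; ring.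
have cE : c = fract (endpoint phi b - w%:R * theta).
  by rewrite -mulrN -back // subnn mul0r addr0 fract_id //; lra.
apply: (nocut b (nhits (hit theta phi x) w) c) => //.
  exact: leq_ltn_trans (leq_nhits _ wu) ur.
exists w; split=> //; first exact: le_lt_trans cy yphi.
apply/esym/nhits_rev => v /andP[v0 vw].
by rewrite agree; [rewrite /hit back // ltnW | lia].
Qed.

(** Indices are counted rather than points: there are [2 * r] of them, and coinciding cuts do no
    harm. *)
Definition ncuts (R : realType) (theta phi : R) (r : nat) (x : R) : nat :=
  #|[set p : bool * 'I_r | `[< exists2 c, cut theta phi p.1 p.2 c & c <= x >]]%SET|.

Lemma ncuts_lt (R : realType) (theta phi : R) r x :
  (ncuts theta phi r x < 2 * r + 1)%N.
Proof.
by rewrite addn1 ltnS (leq_trans (max_card _)) // card_prod card_bool card_ord.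
Qed.

(** The set of indices grows with the point, so equal cardinalities force equal sets. A cut in
    between would put its index in the larger set only, since an index determines its cut. *)
Lemma ncuts_eq (R : realType) (theta phi : R) r x y : x <= y ->
  ncuts theta phi r x = ncuts theta phi r y ->
  forall b k c, (k < r)%N -> x < c -> c <= y -> ~ cut theta phi b k c.
Proof.
move=> xy Nxy b k c kr xc cy cutc; move: Nxy; rewrite /ncuts.
set X := finset _; set Y := finset _ => cardXY.
have XY : X = Y.
  apply/eqP; rewrite eqEcard cardXY leqnn andbT.
  apply/fintype.subsetP => p; rewrite !inE => -[d cutd dx].
  by exists d => //; exact: le_trans dx xy.
have : (b, Ordinal kr) \in Y by rewrite !inE; exists c.
rewrite -XY !inE => -[d cutd].
by rewrite -(cut_unique cutc cutd) leNgt xc.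
Qed.

Lemma enumerates_between T A i t : enumerates T A ->
  (T i < t < T i.+1)%N -> ~ A t.
Proof.
move=> [Tinc <-] /andP[it ti] [j _ jt]; rewrite -jt in it ti.
case: (ltngtP i j) => [ij|/Tinc|ij]; [|lia|by rewrite ij ltnn in it].
case: (ltngtP i.+1 j) => [/Tinc||ij']; [lia|lia|by rewrite -ij' ltnn in ti].
Qed.

Lemma differences_eq T (A : set nat) i j r : enumerates T A ->
  (forall u, (0 < u)%N -> (nhits (fun v => `[< A (T i + v)%N >]) u < r)%N ->
     A (T i + u)%N <-> A (T j + u)%N) ->
  forall k, (k < r)%N ->
  (T (i + k.+1) - T (i + k) = T (j + k.+1) - T (j + k))%N.
Proof.
move=> enumT same; have [Tinc TA] := enumT.
have AT n : A (T n) by rewrite -TA; exists n.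
have TS n : (T n < T n.+1)%N by exact: Tinc.
set h := (X in nhits X) in same.
(* The count runs up to [e.+1] so that a return at a positive offset [e] is itself included. *)
have step k e : (k < r)%N -> (T (i + k) = T i + e)%N ->
    (T (j + k) = T j + e)%N -> (nhits h e.+1 <= k)%N ->
    exists2 u, (nhits h u.+1 <= k.+1)%N &
      (T (i + k.+1) = T i + u)%N /\ (T (j + k.+1) = T j + u)%N.
  move=> kr ei ej hk; rewrite !addnS.
  have Si := TS (i + k)%N; have Sj := TS (j + k)%N.
  pose u := (T (i + k).+1 - T i)%N; pose w := (T (j + k).+1 - T j)%N.
  have hu : (nhits h u <= k)%N.
    rewrite /nhits (big_cat_nat _ (n := e.+1)) //=; last by rewrite /u; lia.
    rewrite [X in (_ + X)%N]big_nat_cond [X in (_ + X)%N]big1 ?addn0 //.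
    move=> v /andP[/andP[ev vu] _]; rewrite /h.
    case: asboolP => // /(enumerates_between enumT (i := i + k)) [].
    by rewrite /u in vu; lia.
  have uE : T (i + k).+1 = (T i + u)%N by rewrite /u; lia.
  have wE : T (j + k).+1 = (T j + w)%N by rewrite /w; lia.
  (* Were the offsets different, [same] would make the smaller one a return after both [T i] and
     [T j], strictly between two consecutive returns of one of them. *)
  have uw : u = w.
    case: (ltngtP u w) => // lt.
      have /same [|Au _] : (0 < u)%N by lia.
        exact: leq_ltn_trans hu kr.
      case: (@enumerates_between _ _ (j + k)%N (T j + u)%N enumT); first by lia.
      by apply: Au; rewrite -uE.
    have /same [|_ Aw] : (0 < w)%N by lia.
      exact: leq_ltn_trans (leq_nhits h (ltnW lt)) (leq_ltn_trans hu kr).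
    case: (@enumerates_between _ _ (i + k)%N (T i + w)%N enumT); first by lia.
    by apply: Aw; rewrite -wE.
  exists u; last by rewrite {2}uw.
  rewrite nhitsS; last by lia.
  by rewrite -[k.+1]addn1 leq_add // leq_b1.
have offset k : (k <= r)%N -> exists2 e, (nhits h e.+1 <= k)%N &
    (T (i + k) = T i + e)%N /\ (T (j + k) = T j + e)%N.
  elim: k => [_|k IH kr]; first by exists 0%N; rewrite ?addn0 // /nhits big_geq.
  by have [e he [ei ej]] := IH (ltnW kr); exact: step kr ei ej he.
move=> k kr; have [e he [ei ej]] := offset k (ltnW kr).
by have [u _ [-> ->]] := step k e kr ei ej he; rewrite ei ej !subnDl.
Qed.

Lemma card_le_range_factor (V : Type) (f : nat -> V) (N : nat -> nat) n :
  (forall i, (N i < n)%N) -> (forall i j, N i = N j -> f i = f j) ->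
  range f #<= `I_n.
Proof.
(* The default 0 is harmless: [g] matters only at values of [N], which have a preimage. *)
move=> Nn Nf; pose g m := f (xget 0%N [set i | N i = m]).
have gN i : g (N i) = f i by apply: Nf; exact: (@xgetI _ 0%N [set k | N k = N i] i).
apply: card_le_trans (card_image_le g `I_n); apply: subset_card_le.
by move=> _ [i _ <-]; exists (N i); [exact: Nn | exact: gN].
Qed.

Theorem theorem1p6 (R : realType) (phi theta : R) (r : nat) (T : nat -> nat) :
  0 < phi < 1 -> 0 < theta < 1 -> (1 <= r)%N ->
  enumerates T (return_times theta phi) ->
  consecutive_differences r T #<= `I_(2 * r + 1)%N.
Proof.
move=> phi01 _ _ enumT; have [_ TA] := enumT.
pose x i := fract ((T i)%:R * theta).
have x_ge0 i : 0 <= x i by have /andP[] := fract_itv ((T i)%:R * theta).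
have x_lt i : x i < phi.
  by have [] : return_times theta phi (T i) by rewrite -TA; exists i.
have hitA i v : (0 < v)%N ->
    hit theta phi (x i) v = `[< return_times theta phi (T i + v)%N >].
  move=> v0; rewrite /hit fract_fractD -mulrDl -natrD; apply/idP/asboolP.
    by split=> //; lia.
  by case.
have nhitsA i u : nhits (fun v => `[< return_times theta phi (T i + v)%N >]) u =
    nhits (hit theta phi (x i)) u.
  by apply: eq_big_nat => v /andP[v0 _]; rewrite hitA.
apply: (@card_le_range_factor _ _ (fun i => ncuts theta phi r (x i))).
  by move=> i; exact: ncuts_lt.
move=> i j; wlog xij : i j / x i <= x j.
  move=> H Nij; case: (leP (x i) (x j)) => [|/ltW] xij; first exact: H.
  by apply/esym/H.
move=> Nij; apply: eq_from_tnth => k; rewrite !tnth_mktuple.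
apply: differences_eq enumT _ _ (ltn_ord k) => u u0; rewrite nhitsA => ur.
(* Equal counts leave no cut between [x i] and [x j], so both points have the same hits while fewer
   than [r] hits precede. *)
have := hit_eq phi01 (x_ge0 i) xij (x_lt j) (ncuts_eq xij Nij) u0 ur.
by rewrite !hitA //; exact: asbool_eq_equiv.
Qed.
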